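(* For all integers $n \ge 4$, $\mathrm{ar}^{\star}(n, K_4) = 2n-3$.
   Context: A star-colouring of a graph $G$ is an edge-colouring of $G$ in which every colour class is a star (a copy of $K_{1,m}$ with $m\ge 1$, a single edge being allowed). An edge-coloured graph is rainbow if all its edges have different colours. For a graph $H$, $\mathrm{ar}^{\star}(n,H)$ denotes the maximum $s\in\mathbb N$ such that there exists a star-colouring of $K_n$ using exactly $s$ colours and without a rainbow copy of $H$. *)

(* Defs.v *)
From mathcomp Require Import all_boot.

Set Implicit Arguments.
Unset Strict Implicit.
Unset Printing Implicit Defensive.

Record sgraph := SGraph {
  vertex :> finType;
  adj : rel vertex;
  adj_sym : symmetric adj;
  adj_irr : irreflexive adj }.

Definition edges (G : sgraph) : {set {set G}} :=
  [set [set p.1; p.2] | p : G * G & adj p.1 p.2].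

Section Complete.
Variable n : nat.
Definition complete_adj : rel 'I_n := fun x y => x != y.
Lemma complete_adj_sym : symmetric complete_adj.
Proof. by move=> x y; rewrite /complete_adj eq_sym. Qed.
Lemma complete_adj_irr : irreflexive complete_adj.
Proof. by move=> x; rewrite /complete_adj eqxx. Qed.
Definition complete : sgraph := SGraph complete_adj_sym complete_adj_irr.
End Complete.

(* The edge set of a copy of K_{1,m} with m = #|L| >= 1. *)
Definition is_star (V : finType) (F : {set {set V}}) : Prop :=
  exists (x : V) (L : {set V}),
    [/\ x \notin L, L != set0 & F = [set [set x; y] | y in L]].

(* An edge-colouring of G is a map c : {set G} -> nat of which only the values
   on edges G matter. *)
Definition colour_class (G : sgraph) (c : {set G} -> nat) (k : nat) :
  {set {set G}} := [set e in edges G | c e == k].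

Definition colours (G : sgraph) (c : {set G} -> nat) : seq nat :=
  undup [seq c e | e in edges G].

Definition star_colouring (G : sgraph) (c : {set G} -> nat) : Prop :=
  forall k, k \in colours c -> is_star (colour_class c k).

(* A copy of H in G, not necessarily induced. *)
Definition is_copy (H G : sgraph) (f : H -> G) : Prop :=
  injective f /\ (forall x y, adj x y -> adj (f x) (f y)).

Definition has_rainbow_copy (H G : sgraph) (c : {set G} -> nat) : Prop :=
  exists f : H -> G,
    is_copy f /\ {in edges H &, injective (fun e : {set H} => c (f @: e))}.

Definition star_colourable_avoiding (n : nat) (H : sgraph) (s : nat) : Prop :=
  exists c : {set complete n} -> nat,
    [/\ star_colouring c, size (colours c) = s & ~ has_rainbow_copy H c].

(* [is_ar_star n H s] reads ar*(n, H) = s. It is a relation because the maximum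
   need not exist for arbitrary n and H (e.g. when H has at most one edge and
   at most n vertices). *)
Definition is_ar_star (n : nat) (H : sgraph) (s : nat) : Prop :=
  star_colourable_avoiding n H s /\
  (forall t, star_colourable_avoiding n H t -> t <= s).

(* Main.v *)
(* In a star-colouring every colour can be given a centre contained in all of
   its edges, so a K_4 is rainbow unless two edges at a common vertex agree.

   Upper bound: take a counterexample with fewest vertices, then fewest colours.
   Merging two colours with the same centre shows that exactly 2n-2 colours
   occur, and deleting a vertex always loses at least three colours.  A colour
   used once is lost at both ends of its edge, any other colour only at its
   centre, so at least n+2 colours are used exactly once.  The graph of these
   single edges therefore has a subgraph W of minimum degree at least 2 with a
   vertex of degree at least 3, hence a path v0 v1 v2 v3.  As this K_4 is not
   rainbow, up to reversal v3 sends the same colour to v0 and v1.  Applying the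
   same reasoning to the K_4's containing v_(i-1), v_i, v_(i+1), where v_(i+1) is
   the next single neighbour of v_i in W, one finds that each v_i sends one colour
   to all of v_1, .., v_(i-2).  So the path never closes up, although W is finite.

   Lower bound: order the vertices and split the edges going down from each
   vertex other than the two lowest into two stars; the top vertex of any K_4
   sees only two colours below it. *)
Require Import Defs.
From mathcomp Require Import all_boot zify.

Set Implicit Arguments.
Unset Strict Implicit.
Unset Printing Implicit Defensive.

(** * Subgraphs of minimum degree at least 2 *)

(** Deleting a vertex of degree at most 1 lowers the degree sum by at most 2 and [2 * #|W|] by
    exactly 2, so the strict inequality survives. Once no such vertex is left, the average degree
    still exceeds 2. *)
Lemma dense_core (T : finType) (e : rel T) (W : {set T}) :
    symmetric e -> irreflexive e ->
    2 * #|W| < \sum_(v in W) #|[set u in W | e v u]| ->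
  exists W' : {set T}, [/\ W' \subset W,
    forall v, v \in W' -> 2 <= #|[set u in W' | e v u]| &
    exists2 v, v \in W' & 3 <= #|[set u in W' | e v u]|].
Proof.
move=> e_sym e_irr.
have [m] := ubnP #|W|; elim: m W => // m IHm W ltWm ltWe.
have [/exists_inP[v Wv degv] | /exists_inPn deg2] :=
    boolP [exists v in W, #|[set u in W | e v u]| <= 1]; last first.
  exists W; split=> //; first by move=> v /deg2; rewrite -ltnNge.
  apply/exists_inP; apply: contraLR ltWe => /exists_inPn deg3.
  rewrite -leqNgt mulnC -sum_nat_const; apply: leq_sum => v /deg3.
  by rewrite -leqNgt.
have degE u : #|[set x in W | e u x]| =
    #|[set x in W :\ v | e u x]| + (e u v : nat).
  rewrite (cardsD1 v) inE Wv /= addnC; congr (_ + _).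
  by apply: eq_card => x; rewrite !inE andbA.
have sumE : \sum_(u in W :\ v) (e u v : nat) = #|[set u in W | e v u]|.
  rewrite -sum1dep_card big_mkcond /= [RHS]big_mkcond /=.
  rewrite [LHS]big_mkcond /=; apply: eq_bigr => u _; rewrite !inE (e_sym v).
  by have [->|_] := eqVneq u v; rewrite ?e_irr ?andbF //=; case: (u \in W); case: (e u v).
have cW : #|W| = #|W :\ v|.+1 by rewrite (cardsD1 v) Wv.
have [|| W' [sW'W deg2 deg3]] := IHm (W :\ v); first by lia.
  move: ltWe; rewrite (bigD1 v) //=.
  rewrite (eq_bigl (mem (W :\ v))); last by move=> u; rewrite !inE andbC.
  under eq_bigr do rewrite degE.
  by rewrite big_split /= sumE; lia.
by exists W'; split=> //; apply: subset_trans sW'W (subD1set _ _).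
Qed.

(** * Centres, cherries and single edges *)

Section CentredColouring.

Variables V K : finType.
Implicit Types (col : V -> V -> K) (h : K -> V) (U W : {set V}).

(** This form of being a star-colouring survives both restriction to fewer vertices and the merging
    of two colours with the same centre. *)
Definition centred h col :=
  forall a b, a != b -> (h (col a b) == a) || (h (col a b) == b).

(** In a centred colouring two distinct edges of one colour meet in its centre, so this says that no
    K_4 is rainbow. *)
Definition K4_cherry col :=
  forall s, uniq s -> size s = 4 -> exists x y z,
    [/\ {subset [:: x; y; z] <= s}, uniq [:: x; y; z] & col x y = col x z].

Definition palette col U : {set K} :=
  [set col p.1 p.2 | p in [set p : V * V | [&& p.1 \in U, p.2 \in U & p.1 != p.2]]].

(* Restricted to U, the colour of ab occurs on ab only; under [centred] it is
   enough to test the edges that meet ab. *)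
Definition single col U : rel V := fun a b =>
  [&& a \in U, b \in U, a != b & [forall t in U, (t != a) ==> (t != b) ==>
    (col a t != col a b) && (col b t != col a b)]].

Lemma paletteP col U k :
  reflect (exists a b, [/\ a \in U, b \in U, a != b & k = col a b])
          (k \in palette col U).
Proof.
apply: (iffP imsetP) => [[[a b]] | [a [b [Ua Ub ab ->]]]].
  by rewrite inE => /and3P[Ua Ub ab] ->; exists a, b.
by exists (a, b); rewrite // inE Ua Ub.
Qed.

Section Fixed.

Variables (h : K -> V) (col : V -> V -> K).
Hypotheses (col_sym : forall a b, col a b = col b a) (col_h : centred h col).

Lemma centre_off x a b : a != b -> x != a -> x != b -> h (col a b) <> x.
Proof.
by move=> nab nxa nxb E; have := col_h nab; rewrite E (negPf nxa) (negPf nxb).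
Qed.

Lemma cherry_centre x y z :
  y != x -> z != x -> y != z -> col x y = col x z -> h (col x y) = x.
Proof.
move=> yx zx yz E; have xy : x != y by rewrite eq_sym.
case/orP: (col_h xy) => /eqP // hy.
by case: (@centre_off y x z); rewrite // 1?eq_sym // -?E.
Qed.

(** Two edges of one colour both contain its centre, so they form a cherry unless they coincide. The
    four cases say which ends are the centre. *)
Lemma cherry_free_inj (s : seq V) :
    (forall x y z, {subset [:: x; y; z] <= s} -> uniq [:: x; y; z] ->
      col x y <> col x z) ->
  forall a b a' b', {subset [:: a; b; a'; b'] <= s} -> a != b -> a' != b' ->
    col a b = col a' b' -> [set a; b] = [set a'; b'].
Proof.
move=> no_cherry.
have shared x y z : {subset [:: x; y; z] <= s} -> x != y -> x != z ->
    col x y = col x z -> y = z.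
  move=> sub xy xz E; apply/eqP; apply: contraPT E => yz; apply: no_cherry => //.
  by rewrite /= !inE negb_or xy xz yz.
move=> a b a' b' sub nab nab' E.
have [sa sb sa' sb'] : [/\ a \in s, b \in s, a' \in s & b' \in s].
  by split; apply: sub; rewrite !inE eqxx ?orbT.
have sub3 x y z : x \in s -> y \in s -> z \in s -> {subset [:: x; y; z] <= s}.
  by move=> ? ? ? t; rewrite !inE => /or3P[] /eqP->.
have nba : b != a by rewrite eq_sym.
have nba' : b' != a' by rewrite eq_sym.
case/orP: (col_h nab) => /eqP h1; case/orP: (col_h nab') => /eqP; rewrite -E h1 => h2;
  [subst a' | subst b' | subst a' | subst b'].
- by rewrite (shared a b b') //; apply: sub3.
- by rewrite [RHS]setUC (shared a b a') //; [apply: sub3 | rewrite E col_sym].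
- by rewrite [LHS]setUC (shared b a b') //; [apply: sub3 | rewrite col_sym].
rewrite setUC [RHS]setUC (shared b a a') //; first exact: sub3.
by rewrite col_sym E col_sym.
Qed.

Lemma single_sym U : symmetric (single col U).
Proof.
suff sub a b : single col U a b -> single col U b a by move=> a b; apply/idP/idP; apply: sub.
case/and4P=> Ua Ub ab /forall_inP H; apply/and4P; split=> //; first by rewrite eq_sym.
apply/forall_inP=> t /H; rewrite (col_sym b a).
by case: (t != a); case: (t != b) => //= /andP[-> ->].
Qed.

Lemma single_irr U : irreflexive (single col U).
Proof. by move=> a; rewrite /single eqxx !andbF. Qed.

Lemma single_neq U a b t :
  single col U a b -> t \in U -> t != a -> t != b -> col a t <> col a b.
Proof.
case/and4P=> _ _ _ /forall_inP H /H; move=> /implyP Ht /Ht /implyP Ht' /Ht'.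
by case/andP=> /eqP.
Qed.

(* The cherries listed are those of the K_4 that avoid both xw and xy. *)
Lemma two_singles U x w y t : K4_cherry col ->
    single col U x w -> single col U x y -> t \in U -> uniq [:: x; w; y; t] ->
  [\/ col t x = col t w \/ col t x = col t y, col t w = col t y,
      col w y = col w t | col y w = col y t].
Proof.
move=> K4 xw xy Ut Us.
have wx := xw; rewrite single_sym in wx.
have yx := xy; rewrite single_sym in yx.
have /and4P[Ux Uw _ _] := xw; have /and4P[_ Uy _ _] := xy.
have nx := single_neq xw; have nw := single_neq wx.
have ny := single_neq yx; have nx' := single_neq xy.
move: (Us); rewrite /= !inE !negb_or => /and4P[/and3P[x1 x2 x3] /andP[x4 x5] x6 _].
have [a [b [d [sub]]]] := K4 _ Us erefl.
move: (sub a) (sub b) (sub d); rewrite !inE !eqxx ?orbT.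
move=> /(_ isT) Ha /(_ isT) Hb /(_ isT) Hd.
rewrite /= !inE !negb_or => /and3P[/andP[ab ad] bd _].
(* All 64 triples are tried: repeated vertices contradict distinctness, and a cherry through [xw] or
   [xy] contradicts singleness. *)
case/or4P: Ha => /eqP Ea; case/or4P: Hb => /eqP Eb; case/or4P: Hd => /eqP Ed;
  subst a b d; rewrite ?eqxx // in ab ad bd; move=> E;
  try (by constructor 1; auto); try (by constructor 2; auto); try (by constructor 3; auto); try (by constructor 4; auto).
all: exfalso; first
  [ by apply: (nx _ _ _ _ E); rewrite // eq_sym
  | by apply: (nx _ _ _ _ (esym E)); rewrite // eq_sym
  | by apply: (nx' _ _ _ _ E); rewrite // eq_sym
  | by apply: (nx' _ _ _ _ (esym E)); rewrite // eq_sym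
  | by apply: (nw _ _ _ _ E); rewrite // eq_sym
  | by apply: (nw _ _ _ _ (esym E)); rewrite // eq_sym
  | by apply: (ny _ _ _ _ E); rewrite // eq_sym
  | by apply: (ny _ _ _ _ (esym E)); rewrite // eq_sym ].
Qed.

(** * Paths of single edges *)

Section Path.

Variables (U W : {set V}).
Hypotheses (K4 : K4_cherry col) (sWU : W \subset U).
Hypothesis deg2 : forall v, v \in W -> 2 <= #|[set u in W | single col U v u]|.

Local Notation sg := (single col U).

Lemma single_next x y :
  x \in W -> exists w, [/\ w \in W, sg x w & w != y].
Proof.
move=> /deg2 d2; have : 0 < #|[set u in W | sg x u] :\ y|.
  by have := cardsD1 y [set u in W | sg x u]; case: (y \in _); lia.
case/card_gt0P=> w; rewrite !inE => /and3P[wy Ww xw]; by exists w.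
Qed.

(* The path x, y, z, r lists v_i, v_(i-1), .., v_1. *)
Definition spiral x y z r :=
  [/\ uniq [:: x, y, z & r], {subset [:: x, y, z & r] <= W},
      [/\ sg x y, sg y z & 0 < size r],
      exists k, forall t, t \in z :: r -> col x t = k &
      forall t, t \in r -> h (col y t) = y].

(** The next single neighbour [w] of [x] is new, since [x] sends one colour to all of [z :: r],
    which has at least two vertices. In the K_4 on [w], [x], [y], [t], first for [t = z] and then
    for [t] in [r], known centres and single edges leave only [col w y = col w t]. *)
Lemma spiral_extend x y z r : spiral x y z r -> exists w, spiral w x y (z :: r).
Proof.
case=> Us sW [xy yz r0] [k Hk] Hy.
have xzr t : t \in z :: r -> col x t = col x z.
  by move=> zrt; rewrite !Hk // mem_head.
move: (Us); rewrite !cons_uniq !inE !negb_or.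
case/and4P=> /and3P[nxy nxz xr] /andP[nyz yr] zr Ur.
have Wx : x \in W by apply: sW; rewrite mem_head.
have WU v : v \in W -> v \in U by apply: (subsetP sWU).
have sU v : v \in [:: x, y, z & r] -> v \in U by move/sW/WU.
have rW v : v \in r -> v \in U by move=> rv; apply: sU; rewrite !inE rv !orbT.
have Uz : z \in U by apply: sU; rewrite !inE eqxx !orbT.
have [t0 rt0] : exists t, t \in r by case: (r) r0 => // t ? _; exists t; rewrite mem_head.
have nxt t : t \in r -> x != t by move=> rt; apply: contraNneq xr => ->.
have nyt t : t \in r -> y != t by move=> rt; apply: contraNneq yr => ->.
have nzt t : t \in r -> z != t by move=> rt; apply: contraNneq zr => ->.
have hx t : t \in z :: r -> h (col x t) = x.
  move=> zrt; rewrite (xzr _ zrt).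
  apply: (@cherry_centre _ _ t0); [by rewrite eq_sym | by rewrite eq_sym nxt | exact: nzt |].
  by rewrite [RHS]xzr // inE rt0 orbT.
have [w [Ww xw wy]] := single_next y Wx.
have wU := WU _ Ww.
have wx : w != x by apply: contraTneq xw => ->; rewrite single_irr.
have wz : w != z.
  apply/eqP=> e; subst w; apply: (single_neq xw (rW _ rt0)).
  - by rewrite eq_sym nxt.
  - by rewrite eq_sym nzt.
  by rewrite xzr // inE rt0 orbT.
have wr t : t \in r -> w != t.
  move=> rt; apply/eqP=> e; subst w; apply: (single_neq xw Uz).
  - by rewrite eq_sym.
  - exact: nzt.
  by rewrite [RHS]xzr // inE rt orbT.
have wyz : col w y = col w z.
  have zy := yz; rewrite single_sym in zy.
  have yz' := single_neq yz; have zy' := single_neq zy.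
  have [|[e|e]|e|e|e] := two_singles K4 xw xy Uz.
  - by rewrite /= !inE !negb_or (eq_sym x w) wx nxy nxz wy wz nyz.
  - have := hx z (mem_head _ _); rewrite (col_sym x z) e.
    by case/centre_off; rewrite // eq_sym.
  - by case: (zy' x); rewrite // ?sU ?mem_head //.
  - by case: (zy' w); rewrite // ?sU ?mem_head //.
  - by [].
  by case: (yz' w); rewrite // ?sU ?mem_head //.
(* This centre, gained from [t = z], rules out [col y w = col y t] for the remaining [t]. *)
have hw : h (col w y) = w.
  by apply: (@cherry_centre _ _ z); rewrite // eq_sym.
have wyt t : t \in r -> col w t = col w z.
  move=> rt; have zrt : t \in z :: r by rewrite inE rt orbT.
  have [xt yt wt] := And3 (nxt _ rt) (nyt _ rt) (wr _ rt).
  have [|[e|e]|e|e|e] := two_singles K4 xw xy (rW _ rt).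
  - by rewrite /= !inE !negb_or (eq_sym x w) wx nxy xt wy wt yt.
  - have := hx t zrt; rewrite (col_sym x t) e.
    by case/centre_off; rewrite // eq_sym.
  - have := hx t zrt; rewrite (col_sym x t) e.
    by case/centre_off; rewrite // eq_sym.
  - have := Hy t rt; rewrite (col_sym y t) -e.
    by case/centre_off; rewrite // eq_sym.
  - by rewrite -e.
  have := hw; rewrite (col_sym w y) e.
  by case/centre_off; rewrite // eq_sym.
exists w; split.
- rewrite cons_uniq Us andbT !inE !negb_or wx wy wz /=.
  by apply/negP=> /wr; rewrite eqxx.
- by move=> v; rewrite inE => /predU1P[->|/sW].
- by split; rewrite ?xy // single_sym.
- by exists (col w z) => t; rewrite !inE => /or3P[/eqP->|/eqP->|/wyt].
exact: hx.
Qed.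

(** Each extension adds a new vertex of [W]; after [#|W|] of them the path is longer than [W]
    allows. *)
Lemma no_spiral x y z r : ~ spiral x y z r.
Proof.
move=> sp; suff [x' [y' [z' [r' [[Us sW _ _ _]]]]]] :
    exists x y z r, spiral x y z r /\ #|W| <= size r.
  have := uniq_leq_size Us (s2 := enum W).
  by rewrite -cardE /= => /(_ (fun v => _)) H; move: (H (fun v vin => etrans (mem_enum _ _) (sW v vin))); lia.
elim: #|W| => [|m [x' [y' [z' [r' [/spiral_extend[w sp'] lem]]]]]].
  by exists x, y, z, r.
by exists w, x', y', (z' :: r').
Qed.

(** Such a cherry would start a spiral: with [w] the next single neighbour of [v3], the K_4 on [w],
    [v3], [v2], [v1] forces [col w v2 = col w v1]. *)
Lemma no_centred_path v0 v1 v2 v3 :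
    uniq [:: v0; v1; v2; v3] -> {subset [:: v0; v1; v2; v3] <= W} ->
    sg v0 v1 -> sg v1 v2 -> sg v2 v3 -> col v3 v0 <> col v3 v1.
Proof.
move=> Us sW s01 s12 s23 e.
have WU v : v \in W -> v \in U by apply: (subsetP sWU).
have [W0 W1 W2 W3] : [/\ v0 \in W, v1 \in W, v2 \in W & v3 \in W].
  by split; apply: sW; rewrite !inE eqxx ?orbT.
move: Us; rewrite /= !inE !negb_or => /and4P[/and3P[n01 n02 n03] /andP[n12 n13] n23 _].
have h3 : h (col v3 v1) = v3.
  by apply: (@cherry_centre _ _ v0); rewrite // eq_sym.
have [w [Ww s3w nw2]] := single_next v2 W3.
have nw3 : w != v3 by apply: contraTneq s3w => ->; rewrite single_irr.
have nw0 : w != v0.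
  by apply/eqP=> E; subst w; apply: (single_neq s3w (WU _ W1)); rewrite // eq_sym.
have nw1 : w != v1.
  by apply/eqP=> E; subst w; apply: (single_neq s3w (WU _ W0)).
have s32 : sg v3 v2 by rewrite single_sym.
have s21 : sg v2 v1 by rewrite single_sym.
have ew : col w v2 = col w v1.
  have [|[E|E]|E|E|E] := two_singles K4 s3w s32 (WU _ W1).
  - rewrite /= !inE !negb_or (eq_sym v3 w) nw3 nw2 nw1 (eq_sym v3 v2) n23.
    by rewrite (eq_sym v3 v1) n13 (eq_sym v2 v1) n12.
  - have := h3; rewrite (col_sym v3 v1) E.
    by case/centre_off; rewrite // eq_sym.
  - by case: (single_neq s12 (WU _ W3)); rewrite // eq_sym.
  - by case: (single_neq s12 (WU _ Ww)).
  - by [].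
  by case: (single_neq s21 (WU _ Ww)).
apply: (@no_spiral w v3 v2 [:: v1]); split.
- by rewrite /= !inE !negb_or nw3 nw2 nw1 !(eq_sym v3) n23 n13 (eq_sym v2 v1) n12.
- by move=> v; rewrite !inE => /or4P[] /eqP->.
- by split; rewrite // single_sym.
- by exists (col w v1) => t; rewrite !inE => /orP[] /eqP->.
by move=> t; rewrite inE => /eqP->.
Qed.

Lemma single_deg_le2 v : v \in W -> #|[set u in W | sg v u]| <= 2.
Proof.
move=> Wv; rewrite leqNgt; apply/negP=> /card_gt2P[a [b [d [[]]]]].
rewrite !inE => /andP[Wa va] /andP[Wb vb] /andP[Wd vd] [ab bd da].
have WU u : u \in W -> u \in U by apply: (subsetP sWU).
have nva u : sg v u -> v != u by case/and4P.
have [u [Wu au uv]] := single_next v Wa.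
have nau : a != u by case/and4P: au.
(* The third single neighbour of [v] is needed here, because [u] may be one of [b] and [d]. *)
have [w [Ww vw wu wa]] : exists w, [/\ w \in W, sg v w, w != u & w != a].
  have [eub|nub] := eqVneq b u; last by exists b; split; rewrite // eq_sym.
  by exists d; split; rewrite // -eub eq_sym.
have Us : uniq [:: u; a; v; w].
  by rewrite /= !inE !negb_or eq_sym nau uv eq_sym wu eq_sym nva // eq_sym wa nva.
have sW : {subset [:: u; a; v; w] <= W}.
  by move=> t; rewrite !inE => /or4P[] /eqP->.
have ua : sg u a by rewrite single_sym.
have av : sg a v by rewrite single_sym.
have wv : sg w v by rewrite single_sym.
have [|[E|E]|E|E|E] := two_singles K4 vw va (WU _ Wu).
- by rewrite /= !inE !negb_or nva // nva // eq_sym uv wa wu nau.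
- apply: (@no_centred_path w v a u) => //.
    by rewrite -[[:: w; v; a; u]]/(rev [:: u; a; v; w]) rev_uniq.
  by move=> t; rewrite -[[:: w; v; a; u]]/(rev [:: u; a; v; w]) mem_rev => /sW.
- by case: (single_neq ua (WU _ Wv)); rewrite ?(nva _ va) // eq_sym.
- by case: (single_neq ua (WU _ Ww)).
- exact: (no_centred_path Us sW ua av vw).
by case: (single_neq au (WU _ Ww)).
Qed.

End Path.

(** * Counting colours *)

(** A lost colour occurs only at [v]. If its centre is not [v], it is the other end of an edge [vu],
    and a second edge of that colour would avoid [v] and keep the colour alive. *)
Lemma lost_colours U v : v \in U ->
  #|palette col U :\: palette col (U :\ v)| <=
  #|[set k in palette col U | h k == v]|
  + #|[set u in U | single col U v u & h (col v u) == u]|.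
Proof.
move=> Uv; set A := [set u in U | _].
apply: leq_trans (_ : #|[set k in palette col U | h k == v] :|: [set col v u | u in A]| <= _).
  apply/subset_leq_card/subsetP=> k; rewrite !inE => /andP[lostk Pk]; rewrite Pk /=.
  case: (eqVneq (h k) v) => //= hkv.
  have [u [Uu nvu Ek]] : exists u, [/\ u \in U, v != u & k = col v u].
    have /paletteP[a [b [Ua Ub nab Ek]]] := Pk.
    have : (a == v) || (b == v).
      apply: contraR lostk; rewrite negb_or => /andP[av bv]; apply/paletteP.
      by exists a, b; rewrite !inE av bv.
    by case/orP=> /eqP E; subst v; [exists b | exists a; rewrite eq_sym col_sym].
  have Eu : h k = u by have := col_h nvu; rewrite -Ek (negPf hkv) => /eqP.
  apply/imsetP; exists u => //; rewrite inE Uu -Ek Eu eqxx andbT /=.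
  apply/and4P; split=> //; apply/forall_inP=> t Ut; apply/implyP=> tv; apply/implyP=> tu.
  rewrite -Ek; apply/andP; split; apply/eqP=> E.
    by case: (@centre_off u v t); rewrite ?E // eq_sym.
  case/negP: lostk; apply/paletteP; exists u, t.
  by rewrite !inE Uu Ut tv [u == v]eq_sym nvu [u == t]eq_sym tu E.
by rewrite (leq_trans (leq_card_setU _ _)) // leq_add2l leq_imset_card.
Qed.

(** The left side counts a single edge at both ends, the right-hand sum only at the end that is not
    its centre. *)
Lemma sum_single_deg U :
  \sum_(v in U) #|[set u in U | single col U v u]| =
  2 * \sum_(v in U) #|[set u in U | single col U v u & h (col v u) == u]|.
Proof.
rewrite mul2n -addnn.
have cardE (P : V -> rel V) v :
    #|[set u in U | P v v u]| = \sum_(u in U) (P v v u : nat).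
  rewrite -sum1dep_card big_mkcondr /=.
  by apply: eq_bigr => u _; case: (P v v u).
under eq_bigr do rewrite (cardE (fun _ => single col U)).
under [X in X + _]eq_bigr do
  rewrite (cardE (fun v _ u => single col U v u && (h (col v u) == u))).
under [X in _ + X]eq_bigr do
  rewrite (cardE (fun v _ u => single col U v u && (h (col v u) == u))).
rewrite [X in _ = X + _]exchange_big -big_split /=; apply: eq_bigr => v Uv.
rewrite -big_split /=; apply: eq_bigr => u Uu.
rewrite (single_sym U u v) (col_sym u v).
have [/and4P[_ _ nvu _]|//] := boolP (single col U v u); rewrite !andTb.
case/orP: (col_h nvu) => /eqP->; first by rewrite eqxx (negPf nvu).
by rewrite eqxx eq_sym (negPf nvu).
Qed.

End Fixed.

Lemma palette_bound h col U :
    (forall a b, col a b = col b a) -> centred h col -> K4_cherry col ->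
    2 <= #|U| -> #|palette col U| + 3 <= 2 * #|U|.
Proof.
(* This measure drops both when a vertex is deleted and when two colours are merged. *)
have [m] := ubnP (#|U| + #|palette col U|).
elim: m col U => [|m IHm] col U; first by rewrite ltn0.
rewrite ltnS => ltm col_sym col_h K4 U2.
have [U2'|U3] := leqP #|U| 2.
  have /cards2P[a [b [nab EU]]] : #|U| == 2 by lia.
  suff : #|palette col U| <= 1 by lia.
  rewrite -(cards1 (col a b)); apply/subset_leq_card/subsetP=> k.
  case/paletteP=> [x [y [+ + + ->]]]; rewrite EU !inE.
  by case/orP=> /eqP-> /orP[] /eqP->; rewrite ?eqxx // col_sym.
rewrite leqNgt; apply/negP=> big.
have hP k : k \in palette col U -> h k \in U.
  by case/paletteP=> a [b [Ua Ub nab ->]]; case/orP: (col_h _ _ nab) => /eqP->.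
(* With more colours, [h] is not injective on the palette; merging two colours with one centre costs
   a single colour and leaves a smaller counterexample. *)
have tight : #|palette col U| + 2 = 2 * #|U|.
  apply/eqP; rewrite eqn_leq andbC; apply/andP; split; first by lia.
  rewrite leqNgt; apply/negP=> large.
  have : ~~ [forall k1 in palette col U, forall k2 in palette col U, (h k1 == h k2) ==> (k1 == k2)].
    apply/negP=> /forall_inP inj.
    have : {in palette col U &, injective h}.
      move=> k1 k2 /inj/forall_inP inj1 /inj1/implyP inj2 E; apply/eqP/inj2.
      by rewrite E.
    move/card_in_imset=> cE.
    have : #|h @: palette col U| <= #|U|.
      by apply/subset_leq_card/subsetP=> _ /imsetP[k /hP ? ->].
    by rewrite cE; lia.
  case/forall_inPn=> k1 Pk1 /forall_inPn[k2 Pk2]; rewrite negb_imply => /andP[/eqP hk nk].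
  pose f k := if k == k2 then k1 else k.
  pose col' a b := f (col a b).
  have hf k : h (f k) = h k by rewrite /f; case: eqP => // ->.
  have PE : palette col' U = palette col U :\ k2.
    apply/setP=> k; rewrite !inE; apply/paletteP/andP.
      case=> a [b [Ua Ub nab ->]]; rewrite /col' /f; case: ifP => [_|/negbT nE]; first by split.
      by split=> //; apply/paletteP; exists a, b.
    case=> nk2 /paletteP[a [b [Ua Ub nab Ek]]]; exists a, b; split=> //.
    by rewrite /col' -Ek /f (negPf nk2).
  have cP : #|palette col U| = #|palette col' U|.+1 by rewrite PE (cardsD1 k2) Pk2.
  suff : #|palette col' U| + 3 <= 2 * #|U| by lia.
  apply: IHm => //; first by lia.
  - by move=> a b; rewrite /col' col_sym.
  - by move=> a b; rewrite /col' hf; apply: col_h.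
  move=> s Us s4; have [x [y [z [sub Uxyz E]]]] := K4 s Us s4.
  by exists x, y, z; split=> //; rewrite /col' E.
(* By induction at most [2 * (#|U| - 1) - 3] of the [2 * #|U| - 2] colours remain. *)
have lost v : v \in U -> 3 <= #|palette col U :\: palette col (U :\ v)|.
  move=> Uv; have cU : #|U| = #|U :\ v|.+1 by rewrite (cardsD1 v) Uv.
  have sub : palette col (U :\ v) \subset palette col U.
    apply/subsetP=> k /paletteP[a [b [/setD1P[_ Ua] /setD1P[_ Ub] nab ->]]].
    by apply/paletteP; exists a, b.
  have := subset_leq_card sub; rewrite cardsDS // => lec.
  suff : #|palette col (U :\ v)| + 3 <= 2 * #|U :\ v| by lia.
  by apply: IHm => //; lia.
have sumP : \sum_(v in U) #|[set k in palette col U | h k == v]| = #|palette col U|.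
  rewrite -[RHS]sum1_card (partition_big h (mem U)) //=; apply: eq_bigr => v Uv.
  by rewrite -sum1dep_card.
have : \sum_(v in U) 3 <= \sum_(v in U) (#|[set k in palette col U | h k == v]|
    + #|[set u in U | single col U v u & h (col v u) == u]|).
  by apply: leq_sum => v Uv; apply: leq_trans (lost v Uv) (lost_colours col_sym col_h Uv).
rewrite sum_nat_const big_split /= sumP => le3.
have := sum_single_deg col_sym col_h U => sumE.
(* By [le3] and [tight] there are at least [#|U| + 2] single edges, so their degree sum exceeds
   [2 * #|U|]. *)
have [||| W [sWU deg2 [v Wv deg3]]] := @dense_core _ (single col U) U.
- exact: single_sym.
- exact: single_irr.
- by rewrite sumE; lia.
by have := single_deg_le2 col_sym col_h K4 sWU deg2 Wv; lia.
Qed.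

End CentredColouring.

Lemma edgesP n (e : {set complete n}) :
  reflect (exists i j : 'I_n, i < j /\ e = [set i; j]) (e \in edges (complete n)).
Proof.
apply: (iffP imsetP) => [[[i j] /= + ->]|[i [j [ltij ->]]]].
  rewrite inE /= /complete_adj neq_ltn => /orP[] lt; first by exists i, j.
  by exists j, i; rewrite setUC.
by exists (i, j); rewrite // inE /= /complete_adj neq_ltn ltij.
Qed.

Lemma edge_pair n (i j : complete n) : i != j -> [set i; j] \in edges (complete n).
Proof. by move=> ij; apply/imsetP; exists (i, j); rewrite // inE. Qed.

(** * From star-colourings of K_n to centred colourings *)

Section UpperBound.

Variables (n : nat) (c : {set complete n} -> nat).
Hypotheses (hn : 4 <= n) (c_star : star_colouring c).
Hypothesis c_K4 : ~ has_rainbow_copy (complete 4) c.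

Let V : finType := complete n.
Let K := 'I_(\max_e c e).+1.

Definition pair_colour (a b : V) : K := inord (c [set a; b]).

Lemma pair_colourE a b : pair_colour a b = c [set a; b] :> nat.
Proof. by rewrite inordK // ltnS leq_bigmax. Qed.

Lemma pair_colour_sym a b : pair_colour a b = pair_colour b a.
Proof. by rewrite /pair_colour setUC. Qed.

Lemma pair_colour_centred : exists h : K -> V, centred h pair_colour.
Proof.
pose x0 : V := Ordinal (leq_trans (isT : 0 < 4) hn).
pose P k x := [forall a, forall b, (a != b) ==> (pair_colour a b == k) ==> ((x == a) || (x == b))].
(* For a colour that occurs, the centre of its star satisfies [P], so the default [x0] is not
   taken. *)
exists (fun k => odflt x0 [pick x | P k x]) => a b ab.
case: pickP => [x /forallP/(_ a)/forallP/(_ b)|/= noP]; first by rewrite ab eqxx.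
have ke : c [set a; b] \in colours c.
  by rewrite mem_undup; apply: image_f; apply: edge_pair.
have [x [L [_ _ classE]]] := c_star ke.
case/negP: (negbT (noP x)); apply/forallP=> a'; apply/forallP=> b'.
apply/implyP=> ab'; apply/implyP=> /eqP/(congr1 val) /=; rewrite !pair_colourE => Ec.
have : [set a'; b'] \in colour_class c (c [set a; b]) by rewrite inE edge_pair ?Ec /=.
rewrite classE => /imsetP[y _ /setP/(_ x)]; rewrite !inE eqxx /=.
by move->.
Qed.

(** Enumerating four vertices without a cherry would give a rainbow copy, by [cherry_free_inj]. *)
Lemma K4_cherry_pair_colour : K4_cherry pair_colour.
Proof.
have [h col_h] := pair_colour_centred.
move=> s Us s4.
pose C x y z := [&& x \in s, y \in s, z \in s, uniq [:: x; y; z]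
  & pair_colour x y == pair_colour x z].
have [/existsP[x /existsP[y /existsP[z /and5P[sx sy sz Uxyz /eqP E]]]]|noC] :=
    boolP [exists x, exists y, exists z, C x y z].
  by exists x, y, z; split=> // t; rewrite !inE => /or3P[] /eqP->.
case: c_K4.
pose x0 : V := Ordinal (leq_trans (isT : 0 < 4) hn).
pose f (i : complete 4) : complete n := nth x0 s i.
have fs i : f i \in s by rewrite mem_nth // s4.
have f_inj : injective f.
  by move=> i j /eqP; rewrite nth_uniq ?s4 // => /eqP/val_inj.
exists f; split.
  by split=> // i j; apply: contra_neq => /f_inj.
move=> e1 e2 /edgesP[i [j [ij ->]]] /edgesP[i' [j' [ij' ->]]] Ec.
apply: (imset_inj f_inj); rewrite !imsetU1 !imset_set1 in Ec *.
have nf (p q : 'I_4) : p < q -> f p != f q.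
  by move=> pq; rewrite (inj_eq f_inj) neq_ltn pq.
apply: (cherry_free_inj pair_colour_sym col_h (s := s)); rewrite ?nf //.
- move=> x y z sub Uxyz /eqP E; case/negP: noC.
  apply/existsP; exists x; apply/existsP; exists y; apply/existsP; exists z.
  by apply/and5P; split=> //; apply: sub; rewrite !inE eqxx ?orbT.
- by move=> t; rewrite !inE => /or4P[] /eqP->.
by apply: val_inj; rewrite /= !pair_colourE.
Qed.

Lemma colours_leq : size (colours c) <= 2 * n - 3.
Proof.
have [h col_h] := pair_colour_centred.
have := palette_bound pair_colour_sym col_h K4_cherry_pair_colour (U := [set: V]).
rewrite cardsT card_ord => /(_ (ltnW (ltnW hn))) bound.
apply: (@leq_trans #|palette pair_colour [set: V]|); last by lia.
have := uniq_leq_size (undup_uniq [seq c e | e in edges (complete n)])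
  (s2 := [seq val k | k in palette pair_colour [set: V]]).
rewrite size_map -cardE; apply=> k; rewrite mem_undup => /imageP[e /edgesP[i [j [ij ->]]] ->].
rewrite -pair_colourE; apply: image_f; apply/paletteP; exists i, j.
by rewrite !inE neq_ltn ij.
Qed.

End UpperBound.

(** * The extremal colouring *)

Section Construction.

Variable n : nat.

(* Ordering the vertices, the edges going down from j form two stars: the edge
   to 0 and the edges to all other vertices. *)
Definition ladder (e : {set complete n}) : nat :=
  (\max_(x in e) (x : 'I_n)).*2 + (0 \in [seq nat_of_ord x | x in e]).

Lemma ladder_pair (i j : 'I_n) : i < j -> ladder [set i; j] = j.*2 + (i == 0 :> nat).
Proof.
move=> ij; rewrite /ladder big_setU1 ?inE ?neq_ltn ?ij // big_set1.
set z := (0 \in _); have -> : z = (i == 0 :> nat).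
  apply/imageP/eqP => [[x]|i0]; last by exists i; rewrite ?i0 // !inE eqxx.
  by rewrite !inE => /orP[] /eqP-> //; lia.
by move=> /=; lia.
Qed.

Lemma ladder_star : star_colouring ladder.
Proof.
move=> k; rewrite mem_undup => /imageP[e /edgesP[i [j [ij ->]]] ->].
rewrite ladder_pair //.
exists j, [set x : 'I_n | (x < j) && ((x == 0 :> nat) == (i == 0 :> nat))]; split.
- by rewrite inE ltnn.
- by apply/set0Pn; exists i; rewrite inE ij eqxx.
apply/setP=> e'; rewrite inE; apply/andP/imsetP.
  case=> /edgesP[a [b [ab ->]]]; rewrite ladder_pair // => /eqP E.
  have Eb : b = j by apply: val_inj => /=; move: E; do 2 case: eqP => _; lia.
  subst b; exists a; last by rewrite setUC.
  by rewrite inE ab /=; move: E; do 2 case: eqP => _; lia.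
case=> x; rewrite inE => /andP[xj /eqP x0] ->; split.
  by apply: edge_pair; rewrite neq_ltn xj orbT.
by rewrite setUC ladder_pair // x0.
Qed.

(** The colours are exactly 3, .., 2n-1: odd ones from edges to 0, even ones from the other edges,
    whose upper end is at least 2. *)
Lemma size_colours_ladder : size (colours ladder) = 2 * n - 3.
Proof.
rewrite -[RHS](size_iota 3); apply/perm_size/uniq_perm; rewrite ?undup_uniq ?iota_uniq //.
move=> k; rewrite mem_undup mem_iota; apply/imageP/idP.
  case=> e /edgesP[i [j [ij ->]]] ->; rewrite ladder_pair //.
  by have := ltn_ord j; case: eqP; lia.
(* Colour [k] occurs on the edge from [k./2] down to 0 if [k] is odd, and down to 1 if [k] is
   even. *)
move=> kn; have jn : k./2 < n by lia.
have lin : ~~ odd k < n by case: (odd k); lia.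
have ij : Ordinal lin < Ordinal jn by rewrite /=; case: (boolP (odd k)) => /=; lia.
exists [set Ordinal lin; Ordinal jn]; first by apply/edgesP; exists (Ordinal lin), (Ordinal jn).
by rewrite ladder_pair //= -[LHS]odd_double_half addnC; case: (odd k).
Qed.

Lemma ladder_no_rainbow_K4 : ~ has_rainbow_copy (complete 4) ladder.
Proof.
case=> f [[f_inj _] c_inj].
have [top _ topP] := arg_maxnP (fun i => f i : 'I_n) (isT : xpredT (ord0 : 'I_4)).
pose A := [set i : 'I_4 | (i != top) && (f i != 0 :> nat)].
(* At most one of the three lower vertices is sent to 0; the other two send the same colour to
   [top]. *)
have A2 : 1 < #|A|.
  pose B := [set i : 'I_4 | f i == 0 :> nat].
  have B1 : #|B| <= 1.
    apply/card_le1_eqP=> p q; rewrite !inE => /eqP p0 /eqP q0.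
    by apply/f_inj/val_inj; rewrite /= p0 q0.
  have : [set: 'I_4] \subset top |: (B :|: A).
    by apply/subsetP=> i _; rewrite !inE; case: (i == top); case: (f i == 0 :> nat).
  move/subset_leq_card; rewrite cardsT card_ord => c4.
  have := leq_trans c4 (leq_card_setU _ _); rewrite cards1 => {}c4.
  by have := leq_trans c4 (leq_add (leqnn 1) (leq_card_setU B A)); lia.
case/card_gt1P: A2 => p [q []]; rewrite !inE => /andP[pt p0] /andP[qt q0] pq.
have below i : i != top -> f i < f top.
  move=> it; rewrite ltn_neqAle [_ <= _]topP // andbT.
  by apply: contra_neq it => /val_inj/f_inj.
have : [set p; top] = [set q; top].
  apply: c_inj; rewrite ?edge_pair // !imsetU1 !imset_set1.
  by rewrite !ladder_pair ?below // (negPf p0) (negPf q0).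
by move/setP/(_ p); rewrite !inE eqxx (negPf pq) (negPf pt).
Qed.

End Construction.

Theorem theorem1p5 (n : nat) (hn : 4 <= n) :
  is_ar_star n (complete 4) (2 * n - 3).
Proof.
split; last by move=> t [c [c_star <- c_K4]]; apply: colours_leq.
exists (@ladder n); split.
- exact: ladder_star.
- exact: size_colours_ladder.
exact: ladder_no_rainbow_K4.
Qed.
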